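(* Let $X\sim N(\mu,\Sigma)$ be a $p\times 1$ random vector with $\Sigma$ non-singular, and let $\hat\Sigma$ (from $n$ independent samples) be non-singular. Let $\Sigma_{\hat\Omega}=U^TV^*U/n$ with \[ V^*=(I_{p^2}+K)(\Sigma\otimes\Sigma),\qquad U=\big[\Sigma\otimes\Sigma\big]^{-1}\Big[(P_d^{-1/2}\otimes P_d^{-1/2})-\tfrac12(I_{p^2}+K)(I_p\otimes\Omega P_d^{-1})D\Big], \] and let $\rho^*=\frac{\mathrm{tr}(\Sigma_{\hat\Omega})}{\mathrm{tr}(\Sigma_{\hat\Omega})+\sum_{i=1}^p\lambda_i^2-p}$, where $\lambda_1,\dots,\lambda_p$ are the eigenvalues of $\Omega$, and suppose $0<\rho^*<1$. Define $\hat V^*$ and $\hat U$ by replacing $\Sigma,P_d,\Omega$ in $V^*,U$ by $\hat\Sigma,\hat P_d,\hat\Omega$, let $\widehat{\mathrm{tr}(\Sigma_{\hat\Omega})}=\mathrm{tr}(\hat U^T\hat V^*\hat U)/n$, and \[ \hat\rho^*=\frac{\widehat{\mathrm{tr}(\Sigma_{\hat\Omega})}}{\widehat{\mathrm{tr}(\Sigma_{\hat\Omega})}+\sum_{i=1}^p\hat\lambda_i^2-p}, \] where $\hat\lambda_1,\dots,\hat\lambda_p$ are the eigenvalues of $\hat\Omega$. Then $\hat\rho^*$ is an $n$-consistent estimator of $\rho^*$ (consistent as $n\to\infty$).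
   Context: $P=\Sigma^{-1}$, $P_d=\mathrm{dg}(P)$, $\Omega=P_d^{-1/2}PP_d^{-1/2}$. From independent samples $X_1,\dots,X_n$, $\hat\Sigma=\frac1n\sum_{i=1}^n(X_i-\bar X)(X_i-\bar X)^T$, $\hat P=\hat\Sigma^{-1}$, $\hat P_d=\mathrm{dg}(\hat P)$, $\hat\Omega=\hat P_d^{-1/2}\hat P\hat P_d^{-1/2}$. $\otimes$ is the Kronecker product. $K$ is the $p^2\times p^2$ commutation matrix $[E_{i,j}]_{i,j=1}^p$, with $E_{i,j}$ the $p\times p$ matrix having a 1 in position $(j,i)$ and 0 elsewhere ($K\mathrm{vec}(A)=\mathrm{vec}(A^T)$, $\mathrm{vec}$ stacking columns). $D=\sum_{i=1}^pE_{i,i}\otimes E_{i,i}$. *)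

(* Defs.v *)
From HB Require Import structures.
From mathcomp Require Import all_boot all_order all_algebra.
From mathcomp Require Import all_classical all_reals all_analysis.
From mathcomp Require Import mxtens.
Set Implicit Arguments. Unset Strict Implicit. Unset Printing Implicit Defensive.
Import Order.TTheory GRing.Theory Num.Theory.
Local Open Scope classical_set_scope.
Local Open Scope ring_scope.

Section Defs.
Context {R : realType} {p : nat}.

(* Kronecker product: mathcomp's tensmx (A *t B), whose row/column index
   k : 'I_(m*n) stands for the pair (k %/ n, k %% n) (block index first). *)

(* commutation matrix K = [E_{i,j}]_{i,j}, E_{i,j} having its 1 at (j,i) *)
Definition commK : 'M[R]_(p * p) :=
  \matrix_(k, l)
    (let: (i, b) := mxtens_unindex k in let: (j, d) := mxtens_unindex l in
     ((b == j) && (d == i))%:R).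

Definition diagD : 'M[R]_(p * p) :=
  \sum_(i < p) ((delta_mx i i : 'M[R]_p) *t (delta_mx i i : 'M[R]_p)).

Definition prec (S : 'M[R]_p) : 'M[R]_p := invmx S.

Definition Pd_mhalf (S : 'M[R]_p) : 'M[R]_p :=
  \matrix_(i, j) (if i == j then (Num.sqrt (prec S i i))^-1 else 0).

Definition Pd_inv (S : 'M[R]_p) : 'M[R]_p :=
  \matrix_(i, j) (if i == j then (prec S i i)^-1 else 0).

Definition Omega (S : 'M[R]_p) : 'M[R]_p := Pd_mhalf S *m prec S *m Pd_mhalf S.

Definition Vstar (S : 'M[R]_p) : 'M[R]_(p * p) :=
  (1%:M + commK) *m (S *t S).

Definition Umat (S : 'M[R]_p) : 'M[R]_(p * p) :=
  invmx (S *t S) *m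
   (Pd_mhalf S *t Pd_mhalf S
    - 2^-1 *: ((1%:M + commK) *m ((1%:M : 'M[R]_p) *t (Omega S *m Pd_inv S))
               *m diagD)).

Definition trSigOmega (S : 'M[R]_p) (n : nat) : R :=
  \tr ((Umat S)^T *m Vstar S *m Umat S) / n%:R.

(* eigenvalues (with multiplicity) of a matrix whose characteristic polynomial
   splits over R (e.g. a real symmetric matrix); [::] otherwise *)
Definition eigs (A : 'M[R]_p) : seq R :=
  match pselect (exists s : seq R, char_poly A = \prod_(x <- s) ('X - x%:P)) with
  | left H => projT1 (cid H)
  | right _ => [::]
  end.

Definition sumsq_eigs (A : 'M[R]_p) : R := \sum_(x <- eigs A) x ^+ 2.

Definition rho_star (S : 'M[R]_p) (n : nat) : R :=
  trSigOmega S n / (trSigOmega S n + sumsq_eigs (Omega S) - p%:R).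

Context {d : measure_display} {T : measurableType d} (P : probability T R).

Definition rvec (Y : 'I_p -> {RV P >-> R}) (w : T) : 'cV[R]_p :=
  \col_j Y j w.

(* Y ~ N(mu, Sigma), via the definition "every nonzero linear combination
   a^T Y is univariate normal N(a^T mu, a^T Sigma a)" (Sigma is assumed
   positive definite below, so the variance is > 0). *)
Definition gaussian_vec (Y : 'I_p -> {RV P >-> R}) (mu : 'cV[R]_p)
    (Sigma : 'M[R]_p) : Prop :=
  forall a : 'cV[R]_p, a != 0 -> forall B : set R, measurable B ->
    P [set w | B ((a^T *m rvec Y w) 0 0)] =
    normal_prob ((a^T *m mu) 0 0) (Num.sqrt ((a^T *m Sigma *m a) 0 0)) B.

(* mutual independence of the random vectors X_0, X_1, ...: product rule on
   the generating pi-system of measurable rectangles, for every finite set of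
   distinct indices *)
Definition indep_vecs (X : nat -> 'I_p -> {RV P >-> R}) : Prop :=
  forall (s : seq nat) (B : nat -> 'I_p -> set R), uniq s ->
    (forall i j, measurable (B i j)) ->
    P [set w | forall i, i \in s -> forall j, B i j (X i j w)] =
    (\prod_(i <- s) P [set w | forall j, B i j (X i j w)])%E.

Definition sample_mean (X : nat -> 'I_p -> {RV P >-> R}) (n : nat) (w : T)
  : 'cV[R]_p := n%:R^-1 *: \sum_(i < n) rvec (X i) w.

Definition sample_cov (X : nat -> 'I_p -> {RV P >-> R}) (n : nat) (w : T)
  : 'M[R]_p :=
  n%:R^-1 *: \sum_(i < n)
    ((rvec (X i) w - sample_mean X n w) *m (rvec (X i) w - sample_mean X n w)^T).

Definition rho_hat (X : nat -> 'I_p -> {RV P >-> R}) (n : nat) (w : T) : R :=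
  rho_star (sample_cov X n w) n.

End Defs.

(* Main.v *)
(** With t = tr(U^T V* U) and s = tr(Omega^2), the latter being the sum of the
    squared eigenvalues of the symmetric matrix Omega, the parameter is
    rho* = (t / n) / (t / n + s - p), and 0 < rho* < 1 forces s <> p.  Hence
    rho* tends to 0, and it suffices that the plug-in version does so in
    probability.  Both t and s are continuous functions of the covariance matrix
    near Sigma, so this reduces to the weak law of large numbers for the sample
    covariance matrix, i.e. to Chebyshev's inequality for the entries of
    X_i - mu and for their pairwise products. *)

Require Import Defs.
From HB Require Import structures.
From mathcomp Require Import all_boot all_order all_algebra.
From mathcomp Require Import all_classical all_reals all_analysis.
From mathcomp Require Import measurable_realfun mxtens complex ring lra.
Import Order.TTheory GRing.Theory Num.Theory.
Import numFieldNormedType.Exports.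
Local Open Scope classical_set_scope.
Local Open Scope ring_scope.

Set Implicit Arguments.
Unset Strict Implicit.
Unset Printing Implicit Defensive.

(** * Squared eigenvalues of a symmetric matrix *)

(** The hypotheses speak of laws, not of moments: normality fixes the law of each linear form, and
    independence is a product rule on rectangles. Means, variances and fourth-moment bounds are
    therefore drawn from the normal density by exponential tilting, covariances by polarization, and
    the vanishing of cross terms by a pi-lambda argument. Fourth moments enter because Chebyshev's
    inequality is applied to products of two coordinates. A second obstacle is that sample
    covariance matrices may be singular. For the limit only matrices near [Sigma] matter, where
    everything that gets inverted is non-zero. The event in the conclusion, however, must be
    measurable over all outcomes, with the default values of [invmx] and of division included. The
    formulas for [Umat], [Vstar] and [Omega] are thus traversed once for an abstract class of
    functions, which is then taken to be the measurable functions and the convergent ones. *)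

Lemma char_poly_conj_mx (K : fieldType) (n : nat) (Q A : 'M[K]_n) :
  Q \in unitmx -> char_poly (invmx Q *m A *m Q) = char_poly A.
Proof.
move=> uQ; rewrite /char_poly /char_poly_mx.
have QK : map_mx polyC (invmx Q) *m map_mx polyC Q = 1%:M.
  by rewrite -map_mxM mulVmx// map_mx1.
have -> : 'X%:M - map_mx polyC (invmx Q *m A *m Q) =
    map_mx polyC (invmx Q) *m ('X%:M - map_mx polyC A) *m map_mx polyC Q.
  rewrite mulmxBr mulmxBl !map_mxM; congr (_ - _).
  by rewrite mul_mx_scalar -scalemxAl QK scalemx1.
by rewrite !det_mulmx mulrAC -det_mulmx QK det1 mul1r.
Qed.

Lemma char_poly_diag_mx (K : fieldType) (n : nat) (D : 'rV[K]_n) :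
  char_poly (diag_mx D) = \prod_(i < n) ('X - (D 0 i)%:P).
Proof.
rewrite char_poly_trig ?diag_mx_is_trig//.
by apply: eq_bigr => i _; rewrite mxE eqxx mulr1n.
Qed.

(** Over the complex numbers the matrix is Hermitian, hence unitarily diagonalizable with real
    diagonal. So its characteristic polynomial splits over [R], which rules out the default branch
    of [eigs]. Whatever list of roots was chosen is a permutation of that diagonal, whose sum of
    squares is the trace of the square. *)
Lemma sumsq_eigs_symmetric (R : realType) (p : nat) (A : 'M[R]_p) :
  A^T = A -> sumsq_eigs A = \tr (A *m A).
Proof.
move=> symA; pose toC := real_complex R.
pose AC : 'M[R[i]]_p := map_mx toC A.
have AC_herm : AC \is hermsymmx.
  apply: realsym_hermsym.
    apply/is_hermitianmxP; rewrite expr0 scale1r map_mx_id//.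
    by rewrite /AC map_trmx symA.
  by apply/mxOverP => i j; rewrite mxE complex_real.
have /orthomx_spectralP ACE := hermitian_normalmx AC_herm.
have Dreal := hermitian_spectral_diag_real AC_herm.
set Q := spectralmx AC in ACE *; set D := spectral_diag AC in ACE Dreal *.
have uQ : Q \in unitmx by exact: spectral_unit.
have charAC : map_poly toC (char_poly A) = \prod_(i < p) ('X - (D 0 i)%:P).
  by rewrite map_char_poly -/AC ACE char_poly_conj_mx// char_poly_diag_mx.
have DE i : toC (complex.Re (D 0 i)) = D 0 i.
  by apply/RRe_real/(mxOverP Dreal).
have exs : exists s : seq R, char_poly A = \prod_(x <- s) ('X - x%:P).
  exists [seq complex.Re (D 0 i) | i <- index_enum 'I_p].
  apply: (map_poly_inj toC); rewrite charAC big_map map_prod_XsubC.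
  by apply: eq_bigr => i _; congr ('X - _%:P); rewrite -[LHS]DE.
rewrite /sumsq_eigs /eigs; case: pselect => [ex_s|//].
case: cid => /= s sE.
apply: (fmorph_inj toC); rewrite rmorph_sum/=.
transitivity (\sum_(i < p) D 0 i ^+ 2).
  move: charAC; rewrite sE map_prod_XsubC -(big_map _ predT (fun x => 'X - x%:P)).
  rewrite -[RHS](big_map (D 0) predT (fun x => 'X - x%:P)).
  move=> /prod_XsubC_eq sD.
  transitivity (\sum_(x <- [seq toC x | x <- s]) x ^+ 2).
    by rewrite big_map; apply: eq_bigr => x _; rewrite rmorphXn.
  by rewrite (perm_big _ sD)/= big_map.
transitivity (\tr (AC *m AC)); last first.
  by rewrite -map_mxM /mxtrace rmorph_sum; apply: eq_bigr => i _; rewrite mxE.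
rewrite ACE !mulmxA mulmxK// mxtrace_mulC !mulmxA mulmxV// mul1mx.
rewrite mulmx_diag mxtrace_diag.
by apply: eq_bigr => i _; rewrite mxE expr2.
Qed.

(** * Closure of measurability and convergence under matrix operations *)

(* Measurability of functions of w and convergence along a filter are both
   stable under the operations from which [Umat], [Vstar] and [Omega] are
   built.  [ok f] is the side condition under which [f] may be inverted:
   vacuous for measurability, a non-zero limit for convergence. *)
Record field_closed (R : realType) (I : Type) (ok : (I -> R) -> Prop)
    (Q : (I -> R) -> Prop) : Prop := FieldClosed {
  fc_cst : forall c, Q (fun=> c) ;
  fc_add : forall f g, Q f -> Q g -> Q (fun x => f x + g x) ;
  fc_mul : forall f g, Q f -> Q g -> Q (fun x => f x * g x) ;
  fc_inv : forall f, ok f -> Q f -> Q (fun x => (f x)^-1) ;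
  fc_sqrt : forall f, Q f -> Q (fun x => Num.sqrt (f x)) ;
  fc_if : forall f g h, ok f -> Q f -> Q g -> Q h ->
    Q (fun x => if f x == 0 then g x else h x) }.

Section FieldClosedTheory.
Variables (R : realType) (I : Type) (ok : (I -> R) -> Prop).
Variables (Q : (I -> R) -> Prop) (QF : field_closed ok Q).

Definition mx_closed (m n : nat) (A : I -> 'M[R]_(m, n)) : Prop :=
  forall i j, Q (fun x => A x i j).

Lemma eq_fc (f g : I -> R) : f =1 g -> Q f -> Q g.
Proof. by move=> /funext ->. Qed.

Lemma fc_sum (J : Type) (r : seq J) (P : pred J) (f : J -> I -> R) :
  (forall j, Q (f j)) -> Q (fun x => \sum_(j <- r | P j) f j x).
Proof.
move=> Qf; elim: r => [|j r IHr].
  by apply: eq_fc (fc_cst QF 0) => x; rewrite big_nil.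
have [Pj|nPj] := boolP (P j).
  by apply: eq_fc (fc_add QF (Qf j) IHr) => x; rewrite big_cons Pj.
by apply: eq_fc IHr => x; rewrite big_cons (negbTE nPj).
Qed.

Lemma fc_prod (J : Type) (r : seq J) (f : J -> I -> R) :
  (forall j, Q (f j)) -> Q (fun x => \prod_(j <- r) f j x).
Proof.
move=> Qf; elim: r => [|j r IHr].
  by apply: eq_fc (fc_cst QF 1) => x; rewrite big_nil.
by apply: eq_fc (fc_mul QF (Qf j) IHr) => x; rewrite big_cons.
Qed.

Lemma mx_closed_cst (m n : nat) (A : 'M[R]_(m, n)) : mx_closed (fun=> A).
Proof. by move=> i j; exact: (fc_cst QF). Qed.

Lemma mx_closedD (m n : nat) (A B : I -> 'M[R]_(m, n)) :
  mx_closed A -> mx_closed B -> mx_closed (fun x => A x + B x).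
Proof.
by move=> QA QB i j; apply: eq_fc (fc_add QF (QA i j) (QB i j)) => x; rewrite mxE.
Qed.

Lemma mx_closedZ (m n : nat) (c : I -> R) (A : I -> 'M[R]_(m, n)) :
  Q c -> mx_closed A -> mx_closed (fun x => c x *: A x).
Proof.
by move=> Qc QA i j; apply: eq_fc (fc_mul QF Qc (QA i j)) => x; rewrite mxE.
Qed.

Lemma mx_closedM (m n k : nat) (A : I -> 'M[R]_(m, n)) (B : I -> 'M[R]_(n, k)) :
  mx_closed A -> mx_closed B -> mx_closed (fun x => A x *m B x).
Proof.
move=> QA QB i j.
have Qs : forall l, Q (fun x => A x i l * B x l j).
  by move=> l; exact: (fc_mul QF (QA i l) (QB l j)).
by apply: eq_fc (fc_sum (index_enum _) xpredT Qs) => x; rewrite mxE.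
Qed.

Lemma mx_closed_tr (m n : nat) (A : I -> 'M[R]_(m, n)) :
  mx_closed A -> mx_closed (fun x => (A x)^T).
Proof. by move=> QA i j; apply: eq_fc (QA j i) => x; rewrite mxE. Qed.

Lemma mx_closed_tens (m n k l : nat) (A : I -> 'M[R]_(m, n))
    (B : I -> 'M[R]_(k, l)) :
  mx_closed A -> mx_closed B -> mx_closed (fun x => A x *t B x).
Proof.
move=> QA QB i j; case: (mxtens_indexP i) => [i0 i1].
case: (mxtens_indexP j) => [j0 j1].
by apply: eq_fc (fc_mul QF (QA i0 j0) (QB i1 j1)) => x; rewrite tensmxE.
Qed.

Lemma fc_tr (n : nat) (A : I -> 'M[R]_n) :
  mx_closed A -> Q (fun x => \tr (A x)).
Proof. by move=> QA; apply: fc_sum => i; exact: QA. Qed.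

Lemma fc_det (n : nat) (A : I -> 'M[R]_n) :
  mx_closed A -> Q (fun x => \det (A x)).
Proof.
move=> QA; apply: fc_sum => s; apply: (fc_mul QF); first exact: (fc_cst QF).
by apply: fc_prod => i; exact: QA.
Qed.

Lemma mx_closed_adj (n : nat) (A : I -> 'M[R]_n) :
  mx_closed A -> mx_closed (fun x => \adj (A x)).
Proof.
move=> QA i j.
have QA' : mx_closed (fun x => row' j (col' i (A x))).
  by move=> k l; apply: eq_fc (QA (lift j k) (lift i l)) => x; rewrite !mxE.
apply: eq_fc (fc_mul QF (fc_cst QF ((-1) ^+ (j + i))) (fc_det QA')) => x.
by rewrite mxE.
Qed.

(** [invmx] returns its argument when the determinant is 0 and the adjugate over the determinant
    otherwise; [fc_if] exists for this case distinction. *)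
Lemma mx_closed_inv (n : nat) (A : I -> 'M[R]_n) :
  ok (fun x => \det (A x)) -> mx_closed A -> mx_closed (fun x => invmx (A x)).
Proof.
move=> okA QA i j; have Qdet := fc_det QA.
have Qadj := fc_mul QF (fc_inv QF okA Qdet) (mx_closed_adj QA i j).
apply: eq_fc (fc_if QF okA Qdet (QA i j) Qadj) => x.
rewrite /invmx unitmxE unitfE.
by have [_|_] := eqVneq (\det (A x)) 0; rewrite //= [RHS]mxE.
Qed.

Variables (p : nat) (S : I -> 'M[R]_p).
Hypothesis QS : mx_closed S.
Hypothesis ok_det : ok (fun x => \det (S x)).
Hypothesis ok_detT : ok (fun x => \det (S x *t S x)).
Hypothesis ok_diag : forall i, ok (fun x => prec (S x) i i).
Hypothesis ok_sqrt : forall i, ok (fun x => Num.sqrt (prec (S x) i i)).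

Lemma mx_closed_prec : mx_closed (fun x => prec (S x)).
Proof. exact: mx_closed_inv. Qed.

Lemma mx_closed_Pd_mhalf : mx_closed (fun x => Pd_mhalf (S x)).
Proof.
move=> i j.
have Qij := fc_inv QF (ok_sqrt i) (fc_sqrt QF (mx_closed_prec i i)).
case: (eqVneq i j) => [ij|/negbTE ij].
  by apply: eq_fc Qij => x; rewrite mxE ij eqxx.
by apply: eq_fc (fc_cst QF 0) => x; rewrite mxE ij.
Qed.

Lemma mx_closed_Pd_inv : mx_closed (fun x => Pd_inv (S x)).
Proof.
move=> i j; have Qij := fc_inv QF (ok_diag i) (mx_closed_prec i i).
case: (eqVneq i j) => [ij|/negbTE ij].
  by apply: eq_fc Qij => x; rewrite mxE ij eqxx.
by apply: eq_fc (fc_cst QF 0) => x; rewrite mxE ij.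
Qed.

Lemma mx_closed_Omega : mx_closed (fun x => Omega (S x)).
Proof.
apply: mx_closedM mx_closed_Pd_mhalf.
exact: mx_closedM mx_closed_Pd_mhalf mx_closed_prec.
Qed.

Lemma mx_closed_Vstar : mx_closed (fun x => Vstar (S x)).
Proof. exact: mx_closedM (mx_closed_cst _) (mx_closed_tens QS QS). Qed.

Lemma mx_closed_Umat : mx_closed (fun x => Umat (S x)).
Proof.
apply: mx_closedM; first exact: mx_closed_inv (mx_closed_tens QS QS).
apply: mx_closedD; first exact: mx_closed_tens mx_closed_Pd_mhalf mx_closed_Pd_mhalf.
rewrite (_ : (fun x => _) = (fun x => (-2^-1) *: ((1%:M + commK) *m
    ((1%:M : 'M[R]_p) *t (Omega (S x) *m Pd_inv (S x))) *m diagD))); last first.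
  by apply/funext => x; rewrite scaleNr.
apply: mx_closedZ; first exact: (fc_cst QF).
apply: mx_closedM (mx_closed_cst _); apply: mx_closedM; first exact: mx_closed_cst.
apply: mx_closed_tens; first exact: mx_closed_cst.
exact: mx_closedM mx_closed_Omega mx_closed_Pd_inv.
Qed.

Lemma fc_tr_UVU :
  Q (fun x => \tr ((Umat (S x))^T *m Vstar (S x) *m Umat (S x))).
Proof.
apply/fc_tr/mx_closedM; last exact: mx_closed_Umat.
exact: mx_closedM (mx_closed_tr mx_closed_Umat) mx_closed_Vstar.
Qed.

Lemma fc_tr_Omega2 : Q (fun x => \tr (Omega (S x) *m Omega (S x))).
Proof. exact/fc_tr/mx_closedM/mx_closed_Omega/mx_closed_Omega. Qed.

End FieldClosedTheory.

Lemma measurable_field_closed (R : realType) (d : measure_display)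
    (T : measurableType d) :
  field_closed (fun=> True) (fun f : T -> R => measurable_fun setT f).
Proof.
split=> [c|f g|f g|f _ mf|f mf|f g h _ mf mg mh].
- exact: measurable_cst.
- exact: measurable_funD.
- exact: measurable_funM.
(* This form reduces inversion to a real power of a non-negative base, whose measurability is known;
   at a zero of [f] both sides are 0. *)
- have -> : (fun x => (f x)^-1) = (fun x => f x * ((f x ^+ 2) `^ (-1))).
    apply/funext => x; rewrite powR_inv1 ?sqr_ge0// expr2 invfM mulrA.
    have [->|fx0] := eqVneq (f x) 0; first by rewrite invr0 !mulr0.
    by rewrite divff// mul1r.
  apply: measurable_funM => //.
  apply: (measurableT_comp (measurable_powR _)).
  exact: measurable_funX.
- apply: (measurableT_comp _ mf).
  by apply: continuous_measurable_fun => x; exact: sqrt_continuous.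
- by apply: measurable_fun_ifT => //; exact: measurable_fun_eqr.
Qed.

(* The limit is carried as the value at the added point [None], so that one
   index type serves both the functions and their limits. *)
Lemma cvg_field_closed (R : realType) (I : Type) (F : set_system I) :
  Filter F ->
  field_closed (fun f => f None != 0)
    (fun f : option I -> R => f (Some x) @[x --> F] --> f None).
Proof.
move=> FF; split=> [c|f g|f g|f|f cf|f g h f0 cf cg ch].
- exact: cvg_cst.
- exact: cvgD.
- exact: cvgM.
- exact: cvgV.
- exact: (continuous_cvg _ (@sqrt_continuous R (f None))).
- rewrite (negbTE f0); apply: cvg_trans ch; apply: near_eq_cvg.
  near=> x; rewrite ifN//; near: x.
  exact: cvgr_neq0 cf f0.
Unshelve. all: by end_near. Qed.

(** * Moments of the normal distribution *)

(** The Radon-Nikodym derivative of [normal_prob] and the explicit density have the same integral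
    over every measurable set, so they agree almost everywhere and may be exchanged under the
    integral. *)
Lemma ge0_integral_normal_prob (R : realType) (m s : R) (f : R -> \bar R) :
  measurable_fun setT f -> (forall x, 0 <= f x)%E ->
  (\int[normal_prob m s]_x f x =
   \int[lebesgue_measure]_x (f x * (normal_pdf m s x)%:E))%E.
Proof.
move=> mf f0.
have mpdf : measurable_fun setT (fun x => (normal_pdf m s x)%:E).
  by apply/measurable_EFinP; exact: measurable_normal_pdf.
rewrite -(Radon_Nikodym_SigmaFinite.change_of_variables
  (normal_prob_dominates m s))//.
set g := Radon_Nikodym_SigmaFinite.f _ _.
have mg : measurable_fun setT g.
  apply: (measurable_int lebesgue_measure).
  exact/Radon_Nikodym_SigmaFinite.f_integrable/normal_prob_dominates.
have g0 x : (0 <= g x)%E.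
  exact/Radon_Nikodym_SigmaFinite.f_ge0/normal_prob_dominates.
apply: ge0_ae_eq_integral => //.
- exact: emeasurable_funM.
- exact: emeasurable_funM.
- by move=> x _; rewrite mule_ge0.
- by move=> x _; rewrite mule_ge0// lee_fin normal_pdf_ge0.
- apply: ae_eqe_mul2l; apply: integral_ae_eq => //.
    exact/Radon_Nikodym_SigmaFinite.f_integrable/normal_prob_dominates.
  move=> E _ mE; rewrite -Radon_Nikodym_SigmaFinite.f_integral//.
  exact: normal_prob_dominates.
Qed.

Section Integrable.
Context (R : realType) (d : measure_display) (T : measurableType d).
Variable P : probability T R.
Local Notation L1 f := (P.-integrable [set: T] (EFin \o f)).
Implicit Types f g : T -> R.

Lemma integrable_le f g : measurable_fun setT f ->
  (forall w, `|f w| <= g w) -> L1 g -> L1 f.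
Proof.
move=> mf fg; apply: le_integrable => //; first exact/measurable_EFinP.
by move=> w _; rewrite /= lee_fin (le_trans (fg w))// ler_norm.
Qed.

Lemma integrable_cst c : L1 (fun=> c).
Proof. exact: finite_measure_integrable_cst. Qed.

Lemma integrable_add f g : L1 f -> L1 g -> L1 (fun w => f w + g w).
Proof. by move=> Lf Lg; apply: eq_integrable (integrableD _ Lf Lg). Qed.

Lemma integrable_scale c f : L1 f -> L1 (fun w => c * f w).
Proof. by move=> Lf; apply: eq_integrable (integrableZl _ c Lf). Qed.

Lemma integrable_mul f g : measurable_fun setT f -> measurable_fun setT g ->
  L1 (fun w => f w ^+ 2) -> L1 (fun w => g w ^+ 2) -> L1 (fun w => f w * g w).
Proof.
move=> mf mg Lf Lg; apply: integrable_le (integrable_add Lf Lg).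
  exact: measurable_funM.
move=> w; rewrite normrM -(real_normK (num_real (f w))).
rewrite -(real_normK (num_real (g w))).
by have := normr_ge0 (f w); have := normr_ge0 (g w); nra.
Qed.

Lemma integrable_of_sqr f : measurable_fun setT f ->
  L1 (fun w => f w ^+ 2) -> L1 f.
Proof.
move=> mf Lf; apply: integrable_le (integrable_add (integrable_cst 1) Lf) => // w.
by rewrite -(real_normK (num_real (f w))); have := normr_ge0 (f w); nra.
Qed.

Lemma expect_cst c : \int[P]_w c = c.
Proof.
rewrite Rintegral_cst// (_ : fine _ = 1) ?mulr1//.
exact: (congr1 fine (probability_setT P)).
Qed.

Lemma expect_affine a b f : L1 f -> \int[P]_w (a + b * f w) = a + b * \int[P]_w f w.
Proof.
move=> Lf; rewrite RintegralD//; last exact: integrable_scale.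
  by rewrite expect_cst RintegralZl.
exact: integrable_cst.
Qed.

End Integrable.

(** The coefficient [k] of [expect_tilt_sqr] at [r = 2], for which [expR (k * (Y - m) ^+ 2)] has
    expectation exactly 2. *)
Definition normal_tilt2 (R : realType) (s : R) : R :=
  (1 - 2^-2) / (s ^+ 2 *+ 2).

(** Comes from [u ^+ 2 <= 4 * expR u] at [u = k * (Y - m) ^+ 2] with [k] the coefficient above; the
    last factor 2 is the expectation of [expR u]. *)
Definition normal4_bound (R : realType) (s : R) : R :=
  4 / normal_tilt2 s ^+ 2 * 2.

Section GaussianMoments.
Context (R : realType) (d : measure_display) (T : measurableType d).
Variables (P : probability T R) (Y : {mfun T >-> R}) (m s : R).
Hypothesis s_gt0 : 0 < s.
Hypothesis lawY : forall B : set R, measurable B ->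
  P (Y @^-1` B) = normal_prob m s B.
Local Notation L1 f := (P.-integrable [set: T] (EFin \o f)).

Lemma ge0_expect_normal (f : R -> R) :
  measurable_fun setT f -> (forall x, 0 <= f x) ->
  (\int[P]_w (f (Y w))%:E =
   \int[lebesgue_measure]_x ((f x)%:E * (normal_pdf m s x)%:E))%E.
Proof.
move=> mf f0.
have mEf : measurable_fun [set: measurableTypeR R] (EFin \o f).
  exact/measurable_EFinP.
have mY : measurable_fun setT (Y : T -> measurableTypeR R).
  exact: (measurable_funPT Y).
pose Y' : {mfun T >-> measurableTypeR R} :=
  HB.pack (Y : T -> measurableTypeR R) (isMeasurableFun.Build _ _ _ _ _ mY).
rewrite -(ge0_integral_normal_prob m s mEf)//.
rewrite -[LHS](@ge0_integral_distribution _ _ _ _ _ P Y' (EFin \o f))//.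
by apply: eq_measure_integral => A mA _; exact: lawY.
Qed.

(** If tilting by [expR (q x)] turns the density into [r] times another normal density, the
    expectation of the tilt is [r], since that density has mass 1. *)
Lemma expect_tilt (q : R -> R) (r m' s' : R) : 0 <= r ->
  measurable_fun setT q ->
  (forall x, expR (q x) * normal_pdf m s x = r * normal_pdf m' s' x) ->
  L1 (fun w => expR (q (Y w))) /\ \int[P]_w expR (q (Y w)) = r.
Proof.
move=> r0 mq qE; have mexp : measurable_fun setT (fun x => expR (q x)).
  exact: measurableT_comp.
have Er : (\int[P]_w (expR (q (Y w)))%:E = r%:E)%E.
  rewrite (ge0_expect_normal mexp) => [|x]; last exact: expR_ge0.
  under eq_integral do rewrite -EFinM qE EFinM.
  rewrite integralZl//; last exact: integrable_normal_pdf.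
  by rewrite integral_normal_pdf mule1.
split; last by rewrite /Rintegral Er.
apply/integrableP; split.
  by apply/measurable_EFinP; exact: (measurableT_comp mexp).
under eq_integral do rewrite /= ger0_norm ?expR_ge0//.
by rewrite Er ltry.
Qed.

Let s0 : s != 0. Proof. by rewrite gt_eqF. Qed.

(* [exp (k (x-m)^2)] times the N(m, s^2) density is [r] times the
   N(m, (r s)^2) density.  Together with [1 + v <= exp v], varying [r] around 1
   pins down the variance without any integration by parts; varying the mean
   ([expect_tilt_lin]) does the same for the expectation. *)
Lemma expect_tilt_sqr r (k := (1 - r^-2) / (s ^+ 2 *+ 2)) : 0 < r ->
  L1 (fun w => expR (k * (Y w - m) ^+ 2)) /\
  \int[P]_w expR (k * (Y w - m) ^+ 2) = r.
Proof.
move=> r0; have rN0 : r != 0 by rewrite gt_eqF.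
apply: (@expect_tilt (fun x => k * (x - m) ^+ 2) r m (r * s)); first exact: ltW.
  by apply: measurable_funM => //; apply: measurable_funX; exact: measurable_funB.
move=> x; rewrite !normal_pdfE// ?mulf_neq0// /normal_peak /normal_fun.
rewrite mulrCA -expRD.
have -> : k * (x - m) ^+ 2 + - (x - m) ^+ 2 / (s ^+ 2 *+ 2) =
    - (x - m) ^+ 2 / ((r * s) ^+ 2 *+ 2).
  by rewrite /k; field; rewrite s0 rN0.
rewrite mulrA; congr (_ * _).
have -> : (r * s) ^+ 2 * pi *+ 2 = r ^+ 2 * (s ^+ 2 * pi *+ 2) by ring.
by rewrite sqrtrM ?sqr_ge0// sqrtr_sqr gtr0_norm// invfM mulVKf.
Qed.

Lemma expect_tilt_lin h
    (q := fun x => h * (x - m) / s ^+ 2 - h ^+ 2 / (s ^+ 2 *+ 2)) :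
  L1 (fun w => expR (q (Y w))) /\ \int[P]_w expR (q (Y w)) = 1.
Proof.
apply: (@expect_tilt q 1 (m + h) s); first exact: ler01.
  apply: measurable_funB => //; apply: measurable_funM => //.
  by apply: measurable_funM => //; exact: measurable_funB.
move=> x; rewrite !normal_pdfE// mul1r /normal_fun mulrCA -expRD.
by congr (_ * expR _); rewrite /q; field.
Qed.

Lemma normal4 : L1 (fun w => (Y w - m) ^+ 4) /\
  \int[P]_w (Y w - m) ^+ 4 <= normal4_bound s.
Proof.
have [] := expect_tilt_sqr (ltr0Sn R 1); rewrite -/(normal_tilt2 s).
set k := normal_tilt2 s => Lexp Eexp.
have k0 : 0 < k.
  rewrite /k /normal_tilt2 divr_gt0//; first by lra.
  by rewrite pmulrn_lgt0// exprn_gt0.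
have LexpZ := integrable_scale (4 / k ^+ 2) Lexp.
have le4 w : (Y w - m) ^+ 4 <= 4 / k ^+ 2 * expR (k * (Y w - m) ^+ 2).
  rewrite mulrAC ler_pdivlMr ?exprn_gt0//.
  set u := k * _; have u0 : 0 <= u by rewrite mulr_ge0 ?sqr_ge0// ltW.
  (* Square [1 + u / 2 <= expR (u / 2)]. *)
  have : u ^+ 2 / 4 <= expR u.
    have := @expR_ge1Dx R (u / 2).
    rewrite -[in expR u](mulfVK (_ : 2 != 0 :> R) u)//.
    have -> : u / 2 * 2 = u / 2 + u / 2 by field.
    by rewrite expRD; nra.
  have -> : (Y w - m) ^+ 4 * k ^+ 2 = u ^+ 2 by rewrite /u; ring.
  by move=> *; lra.
have L4 : L1 (fun w => (Y w - m) ^+ 4).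
  apply: integrable_le LexpZ => [|w].
    by apply: measurable_funX; exact: measurable_funB.
  by rewrite ger0_norm// exprn_even_ge0.
split => //; apply: le_trans (le_Rintegral _ L4 LexpZ _) _ => //.
by rewrite RintegralZl// Eexp /normal4_bound.
Qed.

Lemma integrable_normal2 : L1 (fun w => (Y w - m) ^+ 2).
Proof.
apply: integrable_of_sqr; first by apply: measurable_funX; exact: measurable_funB.
by apply: eq_integrable (proj1 normal4) => // w _; rewrite /= -exprM.
Qed.

Lemma integrable_normal1 : L1 (fun w => Y w - m).
Proof. by apply: integrable_of_sqr integrable_normal2; exact: measurable_funB. Qed.

Lemma expect_normal_center : \int[P]_w (Y w - m) = 0.
Proof.
set e := \int[P]_w _.
(* Integrating [1 + v <= expR v] for the mean-shifting tilt gives this for every real [h]; at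
   [h = e] it reads [e ^+ 2 <= e ^+ 2 / 2], which forces [e = 0]. *)
have he h : h * e <= h ^+ 2 / 2.
  have [Lexp Eexp] := expect_tilt_lin h.
  have : 1 - h ^+ 2 / (s ^+ 2 *+ 2) + h / s ^+ 2 * e <= 1.
    rewrite /e -expect_affine; last exact: integrable_normal1.
    rewrite -[leRHS]Eexp; apply: le_Rintegral => //.
      apply: integrable_add; first exact: integrable_cst.
      exact/integrable_scale/integrable_normal1.
    move=> w _; apply: le_trans (expR_ge1Dx _).
    by rewrite le_eqVlt; apply/orP; left; apply/eqP; ring.
  have -> : 1 - h ^+ 2 / (s ^+ 2 *+ 2) + h / s ^+ 2 * e =
      1 + (h * e - h ^+ 2 / 2) / s ^+ 2 by field.
  by rewrite gerDl pmulr_lle0 ?invr_gt0 ?exprn_gt0// subr_le0.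
by apply/eqP; have := he e; have := sqr_ge0 e; rewrite -sqrf_eq0; lra.
Qed.

Lemma expect_normal_sqr : \int[P]_w (Y w - m) ^+ 2 = s ^+ 2.
Proof.
set e := \int[P]_w _.
have re r : 0 < r -> 1 + (1 - r^-2) / (s ^+ 2 *+ 2) * e <= r.
  move=> r0; have [Lexp Eexp] := expect_tilt_sqr r0.
  rewrite /e -expect_affine; last exact: integrable_normal2.
  rewrite -[leRHS]Eexp; apply: le_Rintegral => //.
    apply: integrable_add; first exact: integrable_cst.
    exact/integrable_scale/integrable_normal2.
  by move=> w _; exact: expR_ge1Dx.
have re' r : 0 < r -> 0 <= (r - 1) * (r ^+ 2 * (s ^+ 2 *+ 2) - (r + 1) * e).
  move=> r0; have := re _ r0; rewrite -subr_ge0.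
  have -> : r - (1 + (1 - r^-2) / (s ^+ 2 *+ 2) * e) =
      ((r - 1) * (r ^+ 2 * (s ^+ 2 *+ 2) - (r + 1) * e)) / (r ^+ 2 * (s ^+ 2 *+ 2)).
    by field; rewrite s0 gt_eqF.
  by rewrite pmulr_lge0// invr_gt0 mulr_gt0 ?exprn_gt0// pmulrn_lgt0// exprn_gt0.
(* the bracket is continuous in [r] and its sign changes at [r = 1] *)
pose g r := r ^+ 2 * (s ^+ 2 *+ 2) - (r + 1) * e.
have gC : {for 1, continuous g}.
  apply: cvgB.
    by apply: cvgM; [exact: exprn_continuous|exact: cvg_cst].
  by apply: cvgM; [apply: cvgD; [exact: cvg_id|exact: cvg_cst]|exact: cvg_cst].
suff : g 1 = 0 by rewrite /g; lra.
apply/eqP; rewrite eq_le; apply/andP; split; rewrite leNgt; apply/negP => g1.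
- have : \forall r \near 1^'-, 0 < g r.
    by apply: (cvgr_gt (g 1)) g1; exact: cvg_at_left_filter.
  move=> gpos; have : \forall r \near (1:R)^'-, False.
    near=> r.
    have r0 : 0 < r by near: r; exact: nbhs_left_gt.
    have r1 : r < 1 by [].
    have gr : 0 < g r by near: r.
    by have := re' _ r0; rewrite -/(g r); nra.
  by move/filter_ex => [].
- have : \forall r \near 1^'+, g r < 0.
    by apply: (cvgr_lt (g 1)) g1; exact: cvg_at_right_filter.
  move=> gneg; have : \forall r \near (1:R)^'+, False.
    near=> r.
    have r1 : 1 < r by [].
    have gr : g r < 0 by near: r.
    have r0 : 0 < r by lra.
    by have := re' _ r0; rewrite -/(g r); nra.
  by move/filter_ex => [].
Unshelve. all: by end_near. Qed.

End GaussianMoments.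

(** * Independence and the weak law of large numbers *)

Section Independence.
Context (R : realType) (d : measure_display) (T : measurableType d).
Variable P : probability T R.
Local Notation L1 f := (P.-integrable [set: T] (EFin \o f)).

(** Both sides are finite measures in [A]: the law of [Z] restricted to [E], and the law of [Z]
    scaled by the mass of [E]. Agreement on a generating pi-system containing the whole space makes
    them equal. *)
Lemma indep_pi_lambda (dV : measure_display) (V : measurableType dV)
    (G : set (set V)) (Z : {mfun T >-> V}) (E : set T) :
  measurable = <<s G >> -> setI_closed G -> G setT -> measurable E ->
  (forall A, G A -> P (Z @^-1` A `&` E) = (P (Z @^-1` A) * P E)%E) ->
  forall A, measurable A -> P (Z @^-1` A `&` E) = (P (Z @^-1` A) * P E)%E.
Proof.
move=> mG GI GT mE PG A mA.
have PE_fin : P E \is a fin_num by exact: fin_num_measure.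
have PE0 : 0 <= fine (P E) by rewrite fine_ge0.
pose m2 := mscale (NngNum PE0) (distribution P Z).
have m2E B : m2 B = (P (Z @^-1` B) * P E)%E.
  by rewrite /m2 /mscale/= fineK// muleC.
rewrite -m2E.
apply: (@measure_unique _ _ _ G (fun=> setT) mG GI _ _
  (pushforward (mrestr P mE) Z) m2) => //.
- by rewrite bigcup_const//; exists 0%N.
- by move=> B GB; apply: (etrans (PG B GB)); exact/esym/m2E.
- move=> _; change (P (Z @^-1` setT `&` E) < +oo)%E.
  by rewrite -ge0_fin_numE// preimage_setT setTI.
Qed.

Lemma indep_pairs (Z Z' : {mfun T >-> (R * R)%type}) :
  (forall A1 A2 B1 B2 : set R,
    measurable A1 -> measurable A2 -> measurable B1 -> measurable B2 ->
    P (Z @^-1` (A1 `*` A2) `&` Z' @^-1` (B1 `*` B2)) =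
    (P (Z @^-1` (A1 `*` A2)) * P (Z' @^-1` (B1 `*` B2)))%E) ->
  forall A B : set (R * R), measurable A -> measurable B ->
    P (Z @^-1` A `&` Z' @^-1` B) = (P (Z @^-1` A) * P (Z' @^-1` B))%E.
Proof.
move=> PZ.
pose G : set (set (R * R)) :=
  [set C | exists A, measurable A /\ exists B, measurable B /\ C = A `*` B].
have mG : measurable = <<s G >>.
  rewrite measurable_prod_measurableType; congr (<<s _ >>).
  rewrite predeqE; split => [[A mA [B mB <-]]|[A [mA [B [mB ->]]]]].
    by exists A; split => //; exists B.
  by exists A => //; exists B.
have GI : setI_closed G.
  move=> /= _ _ [X1 [mX1 [X2 [mX2 ->]]]] [Y1 [mY1 [Y2 [mY2 ->]]]].
  rewrite -setXI; exists (X1 `&` Y1); split; first exact: measurableI.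
  by exists (X2 `&` Y2); split => //; exact: measurableI.
have GT : G setT by exists setT; split => //; exists setT; rewrite setXTT.
move=> A B mA mB.
apply: (indep_pi_lambda mG GI GT) => //; first exact: measurable_funPTI.
move=> _ [A1 [mA1 [A2 [mA2 ->]]]]; rewrite setIC muleC.
apply: (indep_pi_lambda mG GI GT) => //.
  by apply: measurable_funPTI; exact: measurableX.
by move=> _ [B1 [mB1 [B2 [mB2 ->]]]]; rewrite setIC muleC; exact: PZ.
Qed.

(** Independence says that the joint law of [f] and [g] is the product of their laws; the
    expectation of the product then factors by Fubini's theorem. *)
Lemma expect_indep_mul (f g : {mfun T >-> R}) :
  (forall A B : set R, measurable A -> measurable B ->
    P (f @^-1` A `&` g @^-1` B) = (P (f @^-1` A) * P (g @^-1` B))%E) ->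
  L1 f -> L1 g -> L1 (fun w => f w * g w) ->
  \int[P]_w (f w * g w) = (\int[P]_w f w) * (\int[P]_w g w).
Proof.
move=> fg Lf Lg Lfg.
have mfg : measurable_fun setT (fun w => (f w, g w)).
  by apply: measurable_fun_pair.
pose Z : {mfun T >-> (R * R)%type} :=
  HB.pack (fun w => (f w, g w)) (isMeasurableFun.Build _ _ _ _ _ mfg).
pose h : R * R -> \bar R := fun z => (z.1 * z.2)%:E.
have mh : measurable_fun setT h.
  by apply/measurable_EFinP; apply: measurable_funM.
have ZE : forall A, measurable A ->
    (distribution P f \x distribution P g)%E A = distribution P Z A.
  by apply: product_measure_unique => A B mA mB; exact: fg.
have Lh : (distribution P f \x distribution P g)%E.-integrable setT h.
  have /integrableP[_ hoo] : (distribution P Z).-integrable setT h.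
    exact: integrable_pushforward.
  apply/integrableP; split => //; move: hoo.
  by congr (_ < _)%E; apply: eq_measure_integral => A mA _; exact/esym/ZE.
have id_int (u : {mfun T >-> R}) : L1 u ->
    (\int[distribution P u]_x x%:E = (\int[P]_w u w)%:E)%E.
  move=> Lu; rewrite /distribution integral_pushforward//.
  by rewrite /Rintegral fineK//; exact: integrable_fin_num.
apply: EFin_inj; rewrite EFinM.
transitivity (\int[distribution P f \x distribution P g]_z h z)%E.
  rewrite /Rintegral fineK; last exact: integrable_fin_num.
  rewrite (eq_measure_integral (distribution P Z)) => [|A mA _]; last exact: ZE.
  by rewrite /distribution integral_pushforward.
rewrite -(integral12_prod_meas1 Lh)/=.
have innerE x : (\int[distribution P g]_y h (x, y) = x%:E * (\int[P]_w g w)%:E)%E.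
  rewrite -id_int// -integralZl//.
  exact: integrable_pushforward.
transitivity (\int[distribution P f]_x (x%:E * (\int[P]_w g w)%:E))%E.
  by apply: eq_integral => x _; exact: innerE.
rewrite integralZr//; first by rewrite id_int.
exact: integrable_pushforward.
Qed.

End Independence.

(** * Convergence in probability along a filter *)

Lemma cvg_natV (R : realType) : (n%:R^-1 : R) @[n --> \oo] --> (0 : R).
Proof.
rewrite gtr0_cvgV0; first exact: cvgr_idn.
by exists 1%N => // n /= n0; rewrite ltr0n.
Qed.

(* A property of (n, w) holds along this filter when the probability of the
   exceptional w tends to 0 with n, so that [f @ in_prob P --> l] is
   convergence in probability.  The exceptional sets are covered by measurable
   ones because a measure is unconstrained on non-measurable sets. *)
Definition in_prob (R : realType) (d : measure_display) (T : measurableType d)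
    (P : probability T R) : set_system (nat * T) :=
  [set A | exists B : nat -> set T, [/\ forall n, measurable (B n),
    P (B n) @[n --> \oo] --> 0%E & forall n w, ~ B n w -> A (n, w)]].

Section InProb.
Context (R : realType) (d : measure_display) (T : measurableType d).
Variable P : probability T R.
Local Notation L1 f := (P.-integrable [set: T] (EFin \o f)).

#[export] Instance in_prob_filter : Filter (in_prob P).
Proof.
split=> [|A1 A2 [B1 [mB1 PB1 AB1]] [B2 [mB2 PB2 AB2]]|A1 A2 A12 [B [mB PB AB]]].
- by exists (fun=> set0); split => //; under eq_fun do rewrite measure0; exact: cvg_cst.
- exists (fun n => B1 n `|` B2 n); split=> [n||n w /not_orP[? ?]].
  + exact: measurableU.
  + apply: (@squeeze_cvge _ _ _ _ (cst 0%E) _ (fun n => P (B1 n) + P (B2 n))%E).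
    * by apply: nearW => n; rewrite measure_ge0/= measureU2.
    * exact: cvg_cst.
    * by rewrite -(adde0 0%E); apply: cvgeD.
  + by split; [exact: AB1|exact: AB2].
- by exists B; split => // n w /AB; exact: A12.
Qed.

Lemma in_prob_fst : x.1 @[x --> in_prob P] --> \oo.
Proof.
(* For the finitely many [n] below [N] the exceptional set may be the whole space, as only the limit
   of its probability counts. *)
move=> A [N _ NA]; exists (fun n => if (n < N)%N then setT else set0); split.
- by move=> n; case: ifP.
- apply: cvg_near_cst; exists N => // n /= Nn.
  by rewrite ltnNge Nn/= measure0.
- move=> n w /=; case: ltnP => [_ []//|Nn _]; exact: NA.
Qed.

(** Chebyshev's inequality bounds the exceptional probability by [C / e ^+ 2 / n]. Integrability
    accompanies the bound because the real-valued integral would be 0 if the extended one were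
    infinite. *)
Lemma cvg_in_prob_of_bound (f : nat * T -> R) (C : R) :
  (forall n, measurable_fun setT (fun w => f (n, w))) ->
  (forall n, (0 < n)%N -> L1 (fun w => f (n, w) ^+ 2) /\
    \int[P]_w f (n, w) ^+ 2 <= C / n%:R) ->
  f x @[x --> in_prob P] --> 0.
Proof.
move=> mf fC; apply/cvgr0Pnorm_lt => e e0.
exists (fun n => [set w | e <= `|f (n, w)|]); split => [n||n w /=].
- rewrite -[X in measurable X]setTI.
  have mn : measurable_fun setT (fun w => e <= `|f (n, w)|).
    by apply: measurable_fun_ler => //; exact: measurableT_comp.
  exact: (mn measurableT [set true]).
- apply: (@squeeze_cvge _ _ _ _ (cst 0%E) _
    (fun n => (C / e ^+ 2 * n%:R^-1)%:E)).
  + exists 1%N => // n /= n0; rewrite measure_ge0/=.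
    have [L2 E2] := fC n n0.
    pose fn : {mfun T >-> R} :=
      HB.pack (fun w => f (n, w)) (isMeasurableFun.Build _ _ _ _ _ (mf n)).
    have := @markov _ _ _ P fn (fun x => x ^+ 2) e e0.
    have m2 : measurable_fun setT (fun x : R => x ^+ 2) by exact: exprn_measurable.
    move=> /(_ m2 (fun r _ => sqr_ge0 r)) mk.
    have -> : C / e ^+ 2 * n%:R^-1 = (e ^+ 2)^-1 * (C / n%:R) by ring.
    rewrite EFinM -lee_pdivrMl ?invr_gt0 ?exprn_gt0// invrK.
    apply: (le_trans (mk _)).
      by move=> x y; rewrite !nnegrE => x0 y0; rewrite ler_sqr.
    rewrite unlock (_ : integral _ _ _ = (\int[P]_w f (n, w) ^+ 2)%:E) ?lee_fin//.
    rewrite /Rintegral fineK; last exact: integrable_fin_num.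
    by apply: eq_integral => w _ /=; rewrite real_normK// num_real.
  + exact: cvg_cst.
  + apply: cvg_EFin; first exact: nearW.
    rewrite -[X in _ --> X](mulr0 (C / e ^+ 2)).
    by apply: cvgM; [exact: cvg_cst|exact: cvg_natV].
- by move=> /negP; rewrite -ltNge.
Qed.

Lemma weak_lln (D : nat -> {mfun T >-> R}) (C : R) :
  (forall i, L1 (fun w => D i w ^+ 2)) ->
  (forall i, \int[P]_w D i w ^+ 2 <= C) ->
  (forall i k, (i < k)%N -> \int[P]_w (D i w * D k w) = 0) ->
  x.1%:R^-1 * (\sum_(i < x.1) D i x.2) @[x --> in_prob P] --> 0.
Proof.
move=> L2 E2 E0; pose S n w := \sum_(i < n) D i w.
have mS n : measurable_fun setT (S n) by exact: measurable_sum.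
have SS n : S n.+1 = (fun w => S n w + D n w).
  by apply/funext => w; rewrite /S big_ord_recr.
have S0 : S 0%N = (fun=> 0) by apply/funext => w; rewrite /S big_ord0.
have LS n : L1 (fun w => S n w ^+ 2).
  elim: n => [|n IHn]; first by rewrite S0; exact: integrable_cst.
  rewrite SS; apply: integrable_le (integrable_scale 2 (integrable_add IHn (L2 n))).
    by apply: measurable_funX; exact: measurable_funD.
  move=> w /=; rewrite ger0_norm ?sqr_ge0//.
  by have := sqr_ge0 (S n w - D n w); lra.
have LSD n k : L1 (fun w => S n w * D k w) by exact: integrable_mul.
(* [S n] involves only indices below [n], so [k = n] is allowed; this is the cross term in the
   induction step for [S n.+1]. *)
have ESD n k : (n <= k)%N -> \int[P]_w (S n w * D k w) = 0.
  elim: n => [_|n IHn nk].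
    by under eq_Rintegral do rewrite S0 mul0r; rewrite expect_cst.
  under eq_Rintegral do rewrite SS mulrDl.
  rewrite RintegralD// ?IHn 1?ltnW// ?E0 ?addr0//.
  exact: integrable_mul.
have ES n : \int[P]_w S n w ^+ 2 <= C * n%:R.
  elim: n => [|n IHn].
    by under eq_Rintegral do rewrite S0 expr0n; rewrite expect_cst mulr0.
  have -> : \int[P]_w S n.+1 w ^+ 2 =
      \int[P]_w (S n w ^+ 2 + (2 * (S n w * D n w) + D n w ^+ 2)).
    by apply: eq_Rintegral => w _; rewrite SS; ring.
  rewrite RintegralD//; last first.
    by apply: integrable_add => //; exact: integrable_scale.
  rewrite RintegralD//; last exact: integrable_scale.
  by rewrite RintegralZl// ESD// mulr0 add0r -natr1 mulrDr mulr1 lerD.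
apply: (@cvg_in_prob_of_bound (fun x => x.1%:R^-1 * S x.1 x.2) C) => [n|n n0].
  by rewrite /=; apply: measurable_funM; [exact: measurable_cst|exact: mS].
have sqE w : (n%:R^-1 * S n w) ^+ 2 = n%:R ^- 2 * S n w ^+ 2.
  by rewrite exprMn exprVn.
split; first by under eq_fun do rewrite /= sqE; exact: integrable_scale.
under eq_Rintegral do rewrite /= sqE.
rewrite RintegralZl// ler_pdivrMl ?exprn_gt0 ?ltr0n//.
apply: (le_trans (ES n)); rewrite le_eqVlt; apply/orP; left; apply/eqP.
by field; rewrite pnatr_eq0 -lt0n.
Qed.

End InProb.

(** * Gaussian vectors and their sample covariance *)

Section GaussianVectors.
Context (R : realType) (p : nat) (d : measure_display) (T : measurableType d).
Variables (P : probability T R) (Y : 'I_p -> {RV P >-> R}).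
Variables (mu : 'cV[R]_p) (Sigma : 'M[R]_p).
Hypothesis Sigma_sym : Sigma^T = Sigma.
Hypothesis Sigma_pd : forall a : 'cV[R]_p, a != 0 ->
  0 < (a^T *m Sigma *m a) 0 0.
Hypothesis Ygauss : gaussian_vec Y mu Sigma.
Local Notation L1 f := (P.-integrable [set: T] (EFin \o f)).
Local Notation U j w := (Y j w - mu j 0).

Lemma quad_delta (A : 'M[R]_p) (j k : 'I_p) :
  ((delta_mx j 0 : 'cV[R]_p)^T *m A *m (delta_mx k 0 : 'cV[R]_p)) 0 0 = A j k.
Proof. by rewrite trmx_delta -rowE -colE !mxE. Qed.

Lemma delta_dot (v : 'cV[R]_p) (j : 'I_p) :
  ((delta_mx j 0 : 'cV[R]_p)^T *m v) 0 0 = v j 0.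
Proof. by rewrite trmx_delta -rowE mxE. Qed.

Lemma delta_neq0 (j : 'I_p) : delta_mx j 0 != 0 :> 'cV[R]_p.
Proof.
by apply/eqP => /matrixP/(_ j 0)/eqP; rewrite !mxE !eqxx oner_eq0.
Qed.

Lemma measurable_lin (a : 'cV[R]_p) :
  measurable_fun setT (fun w => (a^T *m rvec Y w) 0 0).
Proof.
rewrite (_ : (fun w => _) = (fun w => \sum_(j < p) a j 0 * Y j w)).
  by apply: measurable_sum => j; exact: measurable_funM.
by apply/funext => w; rewrite mxE; apply: eq_bigr => j _; rewrite !mxE.
Qed.

Lemma gaussian_moments (a : 'cV[R]_p) (L : T -> R)
    (v := (a^T *m Sigma *m a) 0 0) :
  a != 0 -> (forall w, L w = (a^T *m (rvec Y w - mu)) 0 0) ->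
  [/\ \int[P]_w L w = 0, \int[P]_w L w ^+ 2 = v,
      L1 (fun w => L w ^+ 4) & \int[P]_w L w ^+ 4 <= normal4_bound (Num.sqrt v)].
Proof.
move=> a0 LE; pose Ya : {mfun T >-> R} := HB.pack (fun w => (a^T *m rvec Y w) 0 0)
  (isMeasurableFun.Build _ _ _ _ _ (measurable_lin a)).
have v0 : 0 < v by exact: Sigma_pd.
have s0 : 0 < Num.sqrt v by rewrite sqrtr_gt0.
have -> : L = (fun w => Ya w - (a^T *m mu) 0 0).
  by apply/funext => w; rewrite LE mulmxBr [LHS]mxE [X in _ + X]mxE.
have lawY B : measurable B ->
    P (Ya @^-1` B) = normal_prob ((a^T *m mu) 0 0) (Num.sqrt v) B.
  exact: Ygauss.
split.
- exact: (expect_normal_center s0 lawY).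
- by rewrite (expect_normal_sqr s0 lawY) sqr_sqrtr// ltW.
- exact: (proj1 (normal4 s0 lawY)).
- exact: (proj2 (normal4 s0 lawY)).
Qed.

Lemma gaussian_coord (j : 'I_p) :
  [/\ \int[P]_w U j w = 0, \int[P]_w (U j w) ^+ 2 = Sigma j j,
      L1 (fun w => (U j w) ^+ 4) &
      \int[P]_w (U j w) ^+ 4 <= normal4_bound (Num.sqrt (Sigma j j))].
Proof.
have := @gaussian_moments _ (fun w => U j w) (delta_neq0 j).
by rewrite quad_delta; apply => w; rewrite delta_dot !mxE.
Qed.

Lemma measurable_coord (j : 'I_p) : measurable_fun setT (fun w => U j w).
Proof. by apply: measurable_funB => //; exact: (measurable_funPT (Y j)). Qed.

Lemma integrable_coord2 (j : 'I_p) : L1 (fun w => (U j w) ^+ 2).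
Proof.
have [_ _ L4 _] := gaussian_coord j; apply: integrable_of_sqr.
  exact/measurable_funX/measurable_coord.
by apply: eq_integrable L4 => // w _; rewrite /= -exprM.
Qed.

Lemma integrable_coordM (j k : 'I_p) : L1 (fun w => U j w * U k w).
Proof.
by apply: integrable_mul;
  [exact: measurable_coord|exact: measurable_coord|exact: integrable_coord2
  |exact: integrable_coord2].
Qed.

(** Polarization: the covariance is read off from the variance of the linear form [U j + U k]. With
    a sum rather than a difference the coefficient vector is non-zero even when [j = k]. *)
Lemma gaussian_covar (j k : 'I_p) : \int[P]_w (U j w * U k w) = Sigma j k.
Proof.
have a0 : delta_mx j 0 + delta_mx k 0 != 0 :> 'cV[R]_p.
  apply/eqP => /matrixP/(_ j 0)/eqP; rewrite !mxE !eqxx /=.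
  by rewrite gt_eqF// ltr_pwDl.
have trD : (delta_mx j 0 + delta_mx k 0 : 'cV[R]_p)^T =
    (delta_mx j 0)^T + (delta_mx k 0)^T by rewrite linearD.
have [w|_ Ejk _ _] := @gaussian_moments _ (fun w => U j w + U k w) a0.
  by rewrite trD mulmxDl [RHS]mxE !delta_dot !mxE.
have [_ Ej _ _] := gaussian_coord j; have [_ Ek _ _] := gaussian_coord k.
move: Ejk; rewrite trD !mulmxDl !mulmxDr.
have addE (A B : 'M[R]_1) : (A + B) 0 0 = A 0 0 + B 0 0 by rewrite mxE.
rewrite !addE !quad_delta.
have -> : Sigma k j = Sigma j k by rewrite -[in LHS]Sigma_sym mxE.
have -> : \int[P]_w (U j w + U k w) ^+ 2
    = \int[P]_w ((U j w) ^+ 2 + (2 * (U j w * U k w) + (U k w) ^+ 2)).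
  by apply: eq_Rintegral => w _; ring.
rewrite RintegralD//; first last.
- apply: integrable_add; last exact: integrable_coord2.
  exact/integrable_scale/integrable_coordM.
- exact: integrable_coord2.
rewrite RintegralD//; first last.
- exact: integrable_coord2.
- exact/integrable_scale/integrable_coordM.
rewrite RintegralZl ?Ej ?Ek//; last exact: integrable_coordM.
by lra.
Qed.

End GaussianVectors.

Section SampleCovariance.
Context (R : realType) (p : nat) (d : measure_display) (T : measurableType d).
Variables (P : probability T R) (X : nat -> 'I_p -> {RV P >-> R}).

Lemma sample_covE n w j k : sample_cov X n w j k = n%:R^-1 * \sum_(i < n)
  ((X i j w - n%:R^-1 * \sum_(l < n) X l j w) *
   (X i k w - n%:R^-1 * \sum_(l < n) X l k w)).
Proof.
have meanE b : sample_mean X n w b 0 = n%:R^-1 * \sum_(l < n) X l b w.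
  by rewrite mxE summxE; congr (_ * _); apply: eq_bigr => l _; rewrite mxE.
rewrite mxE summxE; congr (_ * _); apply: eq_bigr => i _.
by rewrite mxE big_ord1 -!meanE !mxE.
Qed.

Lemma sample_cov_sym n w : (sample_cov X n w)^T = sample_cov X n w.
Proof.
apply/matrixP => j k; rewrite mxE !sample_covE; congr (_ * _).
by apply: eq_bigr => i _; rewrite mulrC.
Qed.

(** Covariance is invariant under translation by [mu]. The averages on the right have terms
    independent of each other for distinct [i], unlike deviations from the sample mean, so the weak
    law applies to them. *)
Lemma sample_cov_center (mu : 'cV[R]_p) n w j k : (0 < n)%N ->
  sample_cov X n w j k =
  n%:R^-1 * \sum_(i < n) ((X i j w - mu j 0) * (X i k w - mu k 0)) -
  (n%:R^-1 * \sum_(i < n) (X i j w - mu j 0)) *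
  (n%:R^-1 * \sum_(i < n) (X i k w - mu k 0)).
Proof.
move=> n0; have nN0 : n%:R != 0 :> R by rewrite pnatr_eq0 -lt0n.
have meanE b : n%:R^-1 * \sum_(l < n) X l b w =
    mu b 0 + n%:R^-1 * \sum_(i < n) (X i b w - mu b 0).
  rewrite sumrB sumr_const card_ord -[mu b 0 *+ n]mulr_natr.
  by rewrite mulrBr mulrCA mulVf// mulr1 subrKC.
rewrite sample_covE !meanE.
set uj := n%:R^-1 * \sum_(i < n) (X i j w - _).
set uk := n%:R^-1 * \sum_(i < n) (X i k w - _).
have termE (i : 'I_n) : (X i j w - (mu j 0 + uj)) * (X i k w - (mu k 0 + uk)) =
    (X i j w - mu j 0) * (X i k w - mu k 0) +
    ((- uk) * (X i j w - mu j 0) + ((- uj) * (X i k w - mu k 0) + uj * uk)).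
  by ring.
under eq_bigr do rewrite termE.
rewrite !big_split/= sumr_const card_ord -[(uj * uk) *+ n]mulr_natr -!mulr_sumr.
rewrite !mulrDr [_ * (- uk * _)]mulrCA [_ * (- uj * _)]mulrCA -/uj -/uk.
by rewrite [_ * (uj * uk * _)]mulrCA mulVf//; ring.
Qed.

Lemma measurable_sample_cov n :
  mx_closed (fun f : T -> R => measurable_fun setT f) (sample_cov X n).
Proof.
move=> j k; rewrite (_ : (fun w => _) = (fun w => n%:R^-1 * \sum_(i < n)
  ((X i j w - n%:R^-1 * \sum_(l < n) X l j w) *
   (X i k w - n%:R^-1 * \sum_(l < n) X l k w)))).
  have mmean b : measurable_fun setT (fun w => n%:R^-1 * \sum_(l < n) X l b w).
    apply: measurable_funM; first exact: measurable_cst.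
    by apply: measurable_sum => l; exact: (measurable_funPT (X l b)).
  apply: measurable_funM; first exact: measurable_cst.
  apply: measurable_sum => i; apply: measurable_funM.
    by apply: measurable_funB => //; exact: (measurable_funPT (X i j)).
  by apply: measurable_funB => //; exact: (measurable_funPT (X i k)).
by apply/funext => w; exact: sample_covE.
Qed.

Variables (mu : 'cV[R]_p) (Sigma : 'M[R]_p).
Hypothesis Sigma_sym : Sigma^T = Sigma.
Hypothesis Sigma_pd : forall a : 'cV[R]_p, a != 0 ->
  0 < (a^T *m Sigma *m a) 0 0.
Hypothesis Xgauss : forall i, gaussian_vec (X i) mu Sigma.
Hypothesis Xindep : indep_vecs X.
Local Notation L1 f := (P.-integrable [set: T] (EFin \o f)).

Lemma indep_coord_pairs (j k : 'I_p) (i l : nat)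
    (Z : nat -> {mfun T >-> (R * R)%type}) :
  (forall n w, Z n w = (X n j w, X n k w)) -> i != l ->
  forall A B : set (R * R), measurable A -> measurable B ->
    P (Z i @^-1` A `&` Z l @^-1` B) = (P (Z i @^-1` A) * P (Z l @^-1` B))%E.
Proof.
move=> ZE il; apply: indep_pairs => A1 A2 B1 B2 mA1 mA2 mB1 mB2.
(* The independence hypothesis takes one set per coordinate. The intersection imposes both
   constraints when [j = k], and the remaining coordinates are left free. *)
pose C A1 A2 (b : 'I_p) : set R :=
  (if b == j then A1 else setT) `&` (if b == k then A2 else setT).
have mC A A' b : measurable A -> measurable A' -> measurable (C A A' b).
  by move=> mA mA'; apply: measurableI; case: ifP.
have CE A A' n : Z n @^-1` (A `*` A') = [set w | forall b, C A A' b (X n b w)].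
  apply/seteqP; split => [w|w /= Cw].
    rewrite /preimage/= ZE => -[/= Aj Ak] b.
    by split; case: eqP => // ->.
  rewrite /= ZE; split => /=; first by have [+ _] := Cw j; rewrite eqxx.
  by have [_] := Cw k; rewrite eqxx.
pose D n b := if n == i then C A1 A2 b else C B1 B2 b.
have mD n b : measurable (D n b) by rewrite /D; case: ifP => _; exact: mC.
have uil : uniq [:: i; l] by rewrite /= inE il.
have := Xindep uil mD; rewrite !big_cons big_nil mule1.
rewrite {2 3}/D eqxx eq_sym (negbTE il) -!CE => <-.
congr (P _); rewrite !CE; apply/seteqP; split => [w [Ci Cl] n|w Cw].
  by rewrite !inE => /orP[]/eqP-> b; rewrite /D ?eqxx// eq_sym (negbTE il).
split => b.
  by have := Cw i _ b; rewrite /D eqxx; apply; rewrite !inE eqxx.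
have := Cw l _ b; rewrite /D eq_sym (negbTE il); apply.
by rewrite !inE eqxx orbT.
Qed.

Lemma weak_lln_pairs (j k : 'I_p) (g : R * R -> R) (C : R)
    (D := fun i w => g (X i j w, X i k w)) :
  measurable_fun setT g ->
  (forall i, L1 (fun w => D i w ^+ 2)) ->
  (forall i, \int[P]_w D i w ^+ 2 <= C) ->
  (forall i, \int[P]_w D i w = 0) ->
  x.1%:R^-1 * (\sum_(i < x.1) D i x.2) @[x --> in_prob P] --> 0.
Proof.
move=> mg L2 E2 E1.
have mZ i : measurable_fun setT (fun w => (X i j w, X i k w)).
  by apply: measurable_fun_pair; exact: measurable_funPT.
pose Z i : {mfun T >-> (R * R)%type} :=
  HB.pack (fun w => (X i j w, X i k w)) (isMeasurableFun.Build _ _ _ _ _ (mZ i)).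
have mD i : measurable_fun setT (D i) by exact: (measurableT_comp mg (mZ i)).
pose Dm i : {mfun T >-> R} :=
  HB.pack (D i) (isMeasurableFun.Build _ _ _ _ _ (mD i)).
apply: (@weak_lln _ _ _ P Dm C) => // i l il.
rewrite expect_indep_mul.
- by rewrite (E1 i : \int[P]_w Dm i w = 0) mul0r.
- move=> A B mA mB.
  have mgA (E : set R) : measurable E -> measurable (g @^-1` E).
    by move=> mE; rewrite -[X in measurable X]setTI; exact: mg.
  have := @indep_coord_pairs j k i l Z (fun _ _ => erefl) _ _ _ (mgA _ mA) (mgA _ mB).
  by apply; rewrite neq_ltn il.
- exact: (integrable_of_sqr (mD i) (L2 i)).
- exact: (integrable_of_sqr (mD l) (L2 l)).
- exact: (integrable_mul (mD i) (mD l) (L2 i) (L2 l)).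
Qed.

Lemma cvg_sample_cov j k :
  sample_cov X x.1 x.2 j k @[x --> in_prob P] --> Sigma j k.
Proof.
have mean0 b : x.1%:R^-1 * (\sum_(i < x.1) (X i b x.2 - mu b 0))
    @[x --> in_prob P] --> 0.
  apply: (@weak_lln_pairs b b (fun z => z.1 - mu b 0) (Sigma b b)) => [|i|i|i].
  - by apply: measurable_funB.
  - exact: (integrable_coord2 Sigma_pd (Xgauss i)).
  - by have [_ ->] := gaussian_coord Sigma_pd (Xgauss i) b.
  - by have [] := gaussian_coord Sigma_pd (Xgauss i) b.
pose N b := normal4_bound (Num.sqrt (Sigma b b)).
have cov0 : x.1%:R^-1 * (\sum_(i < x.1)
      ((X i j x.2 - mu j 0) * (X i k x.2 - mu k 0) - Sigma j k))
    @[x --> in_prob P] --> 0.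
  pose g (z : R * R) := (z.1 - mu j 0) * (z.2 - mu k 0) - Sigma j k.
  have mg : measurable_fun setT g.
    apply: measurable_funB => //; apply: measurable_funM; exact: measurable_funB.
  (* With [a], [b] the centred coordinates and [c] their covariance, the square of [a * b - c] is at
     most [2 * a ^+ 2 * b ^+ 2 + 2 * c ^+ 2], and the first term is at most [a ^+ 4 + b ^+ 4]. *)
  pose B i w := ((X i j w - mu j 0) ^+ 4 + (X i k w - mu k 0) ^+ 4) + 2 * Sigma j k ^+ 2.
  have gB i w : g (X i j w, X i k w) ^+ 2 <= B i w.
    rewrite /g /B/=; set a := _ - mu j 0; set b := _ - mu k 0; set c := Sigma j k.
    have : 0 <= (a * b + c) ^+ 2 by exact: sqr_ge0.
    have : 0 <= (a ^+ 2 - b ^+ 2) ^+ 2 by exact: sqr_ge0.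
    have -> : (a ^+ 2 - b ^+ 2) ^+ 2 = a ^+ 4 + b ^+ 4 - 2 * (a ^+ 2 * b ^+ 2) by ring.
    by lra.
  have LB i : L1 (B i).
    have [_ _ L4j _] := gaussian_coord Sigma_pd (Xgauss i) j.
    have [_ _ L4k _] := gaussian_coord Sigma_pd (Xgauss i) k.
    by apply: integrable_add; [exact: integrable_add|exact: integrable_cst].
  have EB i : \int[P]_w B i w <= N j + N k + 2 * Sigma j k ^+ 2.
    have [_ _ L4j E4j] := gaussian_coord Sigma_pd (Xgauss i) j.
    have [_ _ L4k E4k] := gaussian_coord Sigma_pd (Xgauss i) k.
    rewrite RintegralD//; last exact: integrable_cst.
      by rewrite RintegralD// expect_cst lerD2r lerD.
    exact: integrable_add.
  have Lg2 i : L1 (fun w => g (X i j w, X i k w) ^+ 2).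
    apply: integrable_le (LB i) => [|w]; last by rewrite ger0_norm ?sqr_ge0.
    apply: measurable_funX; apply: (measurableT_comp mg).
    by apply: measurable_fun_pair; exact: measurable_funPT.
  apply: (@weak_lln_pairs j k g (N j + N k + 2 * Sigma j k ^+ 2)) => // i.
  - exact: (le_trans (le_Rintegral measurableT (Lg2 i) (LB i) (fun w _ => gB i w)) (EB i)).
  - rewrite /g RintegralB//; last exact: integrable_cst.
      by rewrite expect_cst (gaussian_covar Sigma_sym Sigma_pd (Xgauss i)) subrr.
    exact: (integrable_coordM Sigma_pd (Xgauss i)).
have -> : Sigma j k = (0 + Sigma j k) - 0 * 0 by rewrite mulr0 subr0 add0r.
apply: cvg_trans (cvgB (cvgD cov0 (cvg_cst (Sigma j k))) (cvgM (mean0 j) (mean0 k))).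
apply: near_eq_cvg.
have pos : \forall x \near in_prob P, (0 < x.1)%N.
  have n0 : \oo [set n | (0 < n)%N] by exists 1%N.
  exact: (@in_prob_fst _ _ _ P _ n0).
near=> x; have x0 : (0 < x.1)%N by near: x.
rewrite (sample_cov_center mu)// !fctE/=; congr (_ - _).
rewrite sumrB sumr_const card_ord [_^-1 * (_ - _)]mulrBr -[Sigma j k *+ x.1]mulr_natl.
rewrite mulKf ?subrK//.
by rewrite pnatr_eq0 -lt0n.
Unshelve. all: by end_near. Qed.

End SampleCovariance.

(** * The shrinkage coefficient as a function of two traces *)

Lemma Pd_mhalf_sym (R : realType) (p : nat) (S : 'M[R]_p) :
  (Pd_mhalf S)^T = Pd_mhalf S.
Proof. by apply/matrixP => i j; rewrite !mxE eq_sym; case: eqP => // ->. Qed.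

Lemma Omega_sym (R : realType) (p : nat) (S : 'M[R]_p) :
  S^T = S -> (Omega S)^T = Omega S.
Proof.
by move=> symS; rewrite /Omega !trmx_mul Pd_mhalf_sym trmx_inv symS mulmxA.
Qed.

(** The quadratic form of [S] at the [i]-th column of its inverse is the [i]-th diagonal entry of
    that inverse. *)
Lemma prec_diag_gt0 (R : realType) (p : nat) (S : 'M[R]_p) (i : 'I_p) :
  S^T = S -> (forall a : 'cV[R]_p, a != 0 -> 0 < (a^T *m S *m a) 0 0) ->
  S \in unitmx -> 0 < prec S i i.
Proof.
move=> symS pdS uS; pose a : 'cV[R]_p := invmx S *m delta_mx i 0.
have a0 : a != 0.
  apply/eqP => /(congr1 (mulmx S)); rewrite mulKVmx// mulmx0.
  by apply/eqP; exact: delta_neq0.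
have := pdS _ a0; rewrite /a trmx_mul trmx_inv symS mulmxKV//.
by rewrite mulmxA quad_delta.
Qed.

Definition rho_of (R : realType) (p : nat) (t s : R) (n : nat) : R :=
  t / n%:R / (t / n%:R + s - p%:R).

Lemma rho_starE (R : realType) (p : nat) (S : 'M[R]_p) (n : nat) : S^T = S ->
  rho_star S n = rho_of p (\tr ((Umat S)^T *m Vstar S *m Umat S))
    (\tr (Omega S *m Omega S)) n.
Proof.
by move=> symS; rewrite /rho_star /rho_of sumsq_eigs_symmetric//; exact: Omega_sym.
Qed.

Theorem theorem5 (R : realType) (p : nat) (d : measure_display)
  (T : measurableType d) (P : probability T R)
  (X : nat -> 'I_p -> {RV P >-> R}) (mu : 'cV[R]_p) (Sigma : 'M[R]_p) :
  Sigma^T = Sigma ->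
  (forall a : 'cV[R]_p, a != 0 -> 0 < (a^T *m Sigma *m a) 0 0) ->
  Sigma \in unitmx ->
  (forall i, gaussian_vec (X i) mu Sigma) ->
  indep_vecs X ->
  (forall n : nat, (0 < n)%N -> 0 < rho_star Sigma n < 1) ->
  forall eps : R, 0 < eps ->
    (fun n : nat =>
       P [set w | eps <= `| rho_hat X n w - rho_star Sigma n |]) @ \oo
    --> 0%E.
Proof.
move=> symS pdS uS Xgauss Xindep rho01 eps eps0.
pose t (S : 'M[R]_p) := \tr ((Umat S)^T *m Vstar S *m Umat S).
pose s (S : 'M[R]_p) := \tr (Omega S *m Omega S).
have rhoE S n : S^T = S -> rho_star S n = rho_of p (t S) (s S) n by exact: rho_starE.
(* If [s Sigma = p], the coefficient at [n = 1] is [t / t], that is 1, or 0 when [t = 0]; the strict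
   bounds exclude both. *)
have den0 : s Sigma - p%:R != 0.
  apply/eqP => sp0; have := rho01 1%N isT.
  rewrite rhoE// /rho_of divr1 -addrA sp0 addr0.
  by have [->|t0] := eqVneq (t Sigma) 0; rewrite ?mul0r ?divff// ltxx ?andbF.
(* In dimension 0 the trace [s Sigma] is an empty sum and equals [p]. A positive dimension serves
   the invertibility of the Kronecker square below. *)
have p0 : p != 0%N.
  by apply: contra_neq den0 => p0; subst p; rewrite /s /mxtrace big_ord0 subr0.
(* Needed at the end, where monotonicity of [P] compares the event of the conclusion with a
   measurable exceptional set. *)
have measurable_rho n : measurable_fun setT (fun w => rho_hat X n w).
  have MF := measurable_field_closed R T.
  rewrite (_ : (fun w => _) = (fun w =>
    rho_of p (t (sample_cov X n w)) (s (sample_cov X n w)) n)); last first.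
    by apply/funext => w; rewrite /rho_hat rhoE//; exact: sample_cov_sym.
  have mt : measurable_fun setT (fun w => t (sample_cov X n w)).
    exact: (fc_tr_UVU MF (measurable_sample_cov X n)).
  have ms : measurable_fun setT (fun w => s (sample_cov X n w)).
    exact: (fc_tr_Omega2 MF (measurable_sample_cov X n)).
  have mtn : measurable_fun setT (fun w => t (sample_cov X n w) / n%:R).
    by apply: measurable_funM.
  apply: measurable_funM => //; apply: (fc_inv MF) => //.
  by apply: measurable_funB => //; exact: measurable_funD.
pose S x := if x is Some (n, w) then sample_cov X n w else Sigma.
have CF := cvg_field_closed R (in_prob_filter P).
have QS : mx_closed (fun f : option (nat * T) -> R =>
    f (Some x) @[x --> in_prob P] --> f None) S.
  move=> j k; have cjk : sample_cov X x.1 x.2 j k @[x --> in_prob P] --> Sigma j k.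
    exact: (cvg_sample_cov symS pdS Xgauss Xindep).
  by apply: cvg_trans cjk; apply: near_eq_cvg; apply: nearW => -[].
have detS : \det (S None) != 0 by rewrite -unitfE -unitmxE.
have detT : \det (S None *t S None) != 0.
  by rewrite -unitfE -unitmxE tensmx_unit.
have diagS i : prec (S None) i i != 0 by rewrite gt_eqF// prec_diag_gt0.
have sqrtS i : Num.sqrt (prec (S None) i i) != 0.
  by rewrite gt_eqF// sqrtr_gt0 prec_diag_gt0.
have ct := fc_tr_UVU CF QS detS detT diagS sqrtS.
have cs := fc_tr_Omega2 CF QS detS sqrtS.
have nV : (x.1%:R^-1 : R) @[x --> in_prob P] --> 0.
  exact: (cvg_comp _ _ (@in_prob_fst _ _ _ P) (@cvg_natV R)).
have rho_cvg (u v : nat * T -> R) : u x @[x --> in_prob P] --> t Sigma ->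
    v x @[x --> in_prob P] --> s Sigma ->
    rho_of p (u x) (v x) x.1 @[x --> in_prob P] --> 0.
  move=> cu cv.
  have cun : u x * x.1%:R^-1 @[x --> in_prob P] --> 0.
    by rewrite -(mulr0 (t Sigma)); exact: cvgM.
  have cden : u x * x.1%:R^-1 + v x - p%:R @[x --> in_prob P] --> s Sigma - p%:R.
    rewrite -[s Sigma]add0r; apply: cvgB; last exact: cvg_cst.
    exact: cvgD.
  by rewrite -(mul0r (s Sigma - p%:R)^-1); exact: (cvgM cun (cvgV den0 cden)).
have hat0 : rho_hat X x.1 x.2 @[x --> in_prob P] --> 0.
  have h : rho_of p (t (S (Some x))) (s (S (Some x))) x.1 @[x --> in_prob P] --> 0.
    exact: (rho_cvg _ _ ct cs).
  apply: cvg_trans h; apply: near_eq_cvg.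
  by apply: nearW => -[n w]; rewrite /rho_hat rhoE//; exact: sample_cov_sym.
have star0 : rho_star Sigma x.1 @[x --> in_prob P] --> 0.
  have h : rho_of p (t Sigma) (s Sigma) x.1 @[x --> in_prob P] --> 0.
    by apply: rho_cvg; exact: cvg_cst.
  apply: cvg_trans h; apply: near_eq_cvg.
  by apply: nearW => -[n w]; rewrite rhoE.
have diff0 : rho_hat X x.1 x.2 - rho_star Sigma x.1 @[x --> in_prob P] --> 0.
  by rewrite -[X in _ --> X](subr0 0); exact: (cvgB hat0 star0).
have /cvgr0Pnorm_lt/(_ _ eps0)[B [mB PB0 ltB]] := diff0.
apply: (@squeeze_cvge _ _ _ _ (cst 0%E) _ (P \o B)) => //; last exact: cvg_cst.
apply: nearW => n; rewrite measure_ge0/=; apply: le_measure.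
- rewrite inE -[X in measurable X]setTI.
  have mle : measurable_fun setT
      (fun w => eps <= `|rho_hat X n w - rho_star Sigma n|).
    apply: measurable_fun_ler => //; apply: measurableT_comp => //.
    exact: measurable_funB.
  exact: (mle measurableT [set true]).
- by rewrite inE.
- move=> w /= le_w; apply: contrapT => /ltB /=.
  by rewrite ltNge le_w.
Qed.
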